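(* Let $k\geq 2$, let $\mathbf{k}$ be a field, let $\beta\in\mathbb Z_{\geq 0}^k$, and let $V_1,\ldots,V_k$ be vector spaces over $\mathbf{k}$ with $\dim V_i=\beta_i$ for $1\leq i\leq k$, each equipped with an ordered basis. Let $Z\subseteq\prod_{i=1}^k V_i$ be the set of tuples $(v_1,\ldots,v_k)$ for which some $v_i=0$. Then there is a bijection $$\mathcal N(\beta)\times\prod_{i=1}^k V_i\;\cong\;\mathrm{Rep}(Q,\beta)\times Z .$$
   Context: Indices are taken modulo $k$. $Q$ is the cyclic quiver $1\to 2\to\cdots\to k\to 1$. The representation space is $\mathrm{Rep}(Q,\beta)=\prod_{i=1}^k\mathrm{Hom}_{\mathbf{k}}(V_i,V_{i+1})$. A representation $f=(f_1,\ldots,f_k)\in\mathrm{Rep}(Q,\beta)$, with $f_i:V_i\to V_{i+1}$, is nilpotent if for each $1\leq i\leq k$ and all sufficiently large $\ell$ the composition $f_{i+\ell-1}\circ\cdots\circ f_i$ is zero. $\mathcal N(\beta)\subseteq\mathrm{Rep}(Q,\beta)$ is the subset of nilpotent representations. *)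

(* Defs.v *)
From HB Require Import structures.
From mathcomp Require Import all_boot all_order all_algebra.
From mathcomp Require Import boolp classical_sets functions.

Set Implicit Arguments.
Unset Strict Implicit.
Unset Printing Implicit Defensive.

Import GRing.Theory.
Local Open Scope ring_scope.
Local Open Scope classical_set_scope.

(* The vertices 1, ..., k of the cyclic quiver are the elements 0, ..., k-1 of
   'I_k; the arrow leaving i ends at ordS i, of value i.+1 %% k. *)
Section CyclicQuiver.
Context (k : nat) (K : fieldType) (V : 'I_k -> vectType K).

Definition Vprod : Type := forall i : 'I_k, V i.

Definition Rep : Type := forall i : 'I_k, 'Hom(V i, V (ordS i)).

(* f_{i+l-1} \o ... \o f_i : V_i -> V_{i+l}; the empty composition (l = 0) is
   the identity. *)
Fixpoint path_map (f : Rep) (i : 'I_k) (l : nat) :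
    'Hom(V i, V (iter l (@ordS k) i)) :=
  if l is l'.+1 then (f (iter l' (@ordS k) i) \o path_map f i l')%VF
  else \1%VF.

Definition nilpotent_rep (f : Rep) : Prop :=
  forall i : 'I_k, exists l0 : nat,
    forall l : nat, (l0 <= l)%N -> path_map f i l = 0.

Definition nilpotent_cone : set Rep := [set f | nilpotent_rep f].

Definition some_zero : set Vprod := [set v | exists i : 'I_k, v i = 0].

End CyclicQuiver.

(* Main.v *)
(* The nonzero terms of the chain x, S x, S^2 x, ... of a nilpotent S form an
   ordered basis of an S-stable subspace X.  Replacing S on X by the automorphism
   that takes a chosen basis of X to this ordered basis turns the pair (S, x)
   into an arbitrary endomorphism S': one recovers X as the largest subspace with
   S' X = X.

   For the quiver, fix an arrow f_p : V_p -> V_s and let D : V_s -> V_p be the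
   composition of all the other arrows.  Then f is nilpotent iff D f_p is, and
   the bijection above, applied to (D f_p, D v_s) and lifted along a linear
   section of D, turns the pairs (f nilpotent, v) into the pairs (f, v) with
   D v_s = 0.  Finally, going once around the quiver from s, exchange at each
   vertex i with v_i <> 0 the vector v_{i+1} with f_i v_i: the condition that
   the path of v_s under f dies before closing up becomes "some v_i is 0". *)
Require Import Defs.
From HB Require Import structures.
From mathcomp Require Import all_boot all_order all_algebra.
From mathcomp Require Import boolp classical_sets functions.

Set Implicit Arguments.
Unset Strict Implicit.
Unset Printing Implicit Defensive.

Import GRing.Theory.
(* MathComp's [path.path_map] would otherwise hide the one of [Defs]. *)
Import Defs.
Local Open Scope ring_scope.
Local Open Scope classical_set_scope.

(** * Linear maps prescribed on a free family *)

Section LinearExtension.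
Context (K : fieldType) (U W : vectType K) (n : nat).
Implicit Types (b : n.-tuple U) (w : nat -> W).

Definition lin_ext_fun b w (y : U) : W := \sum_(i < n) coord b i y *: w i.

Lemma lin_ext_is_linear b w : linear (lin_ext_fun b w).
Proof.
move=> a u v; rewrite /lin_ext_fun scaler_sumr -big_split; apply: eq_bigr => i _.
by rewrite linearP scalerDl scalerA.
Qed.

HB.instance Definition _ b w :=
  GRing.isLinear.Build K U W _ (lin_ext_fun b w) (lin_ext_is_linear b w).

Definition lin_ext b w : 'Hom(U, W) := linfun (lin_ext_fun b w).

Lemma lin_extE b w y : lin_ext b w y = \sum_(i < n) coord b i y *: w i.
Proof. by rewrite lfunE. Qed.

Lemma lin_ext_free b w (i : 'I_n) : free b -> lin_ext b w b`_i = w i.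
Proof.
move=> fb; rewrite lin_extE (bigD1 i) //= coord_free // eqxx scale1r big1 ?addr0 //.
by move=> j ji; rewrite coord_free // eq_sym (negPf ji) scale0r.
Qed.

End LinearExtension.

(** * Nilpotent endomorphisms with a vector versus all endomorphisms *)

Section Endomorphisms.
Context (K : fieldType) (U : vectType K).
Implicit Types (S T : 'End(U)) (x y : U) (X Y R : {vspace U}).

Definition nilpotent_end S : Prop := exists n, forall x, iter n S x = 0.

Lemma iter_lfun0 S n : iter n S 0 = 0.
Proof. by elim: n => //= n ->; rewrite linear0. Qed.

Lemma iter_lfun_eq0 S m n x : (m <= n)%N -> iter m S x = 0 -> iter n S x = 0.
Proof. by move=> mn x0; rewrite -(subnK mn) iterD x0 iter_lfun0. Qed.

Lemma iter_lfun_pow S n : exists T, forall x, T x = iter n S x.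
Proof.
elim: n => [|n [T TE]]; first by exists \1%VF => x; rewrite lfunE.
by exists (S \o T)%VF => x; rewrite lfunE /= TE.
Qed.

Definition is_chain_length S x (m : nat) : Prop :=
  iter m S x = 0 /\ forall j, iter j S x = 0 -> (m <= j)%N.

Lemma is_chain_length_inj S x m1 m2 :
  is_chain_length S x m1 -> is_chain_length S x m2 -> m1 = m2.
Proof. by move=> [z1 l1] [z2 l2]; apply/eqP; rewrite eqn_leq l1 // l2. Qed.

(** In a chain of length [m.+1], [S^m] kills every term after [x] but not [x], so [x] is outside the
    span of the tail. *)
Lemma chain_free S x m : is_chain_length S x m -> free (traject S x m).
Proof.
elim: m x => [|m IH] x [x0 xmin]; first by rewrite nil_free.
rewrite trajectS free_cons IH ?andbT; last first.
  by split=> [|j]; rewrite -iterSr // => /xmin.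
have [T TE] := iter_lfun_pow S m.
have sT : (<<traject S (S x) m>> <= lker T)%VS.
  apply/span_subvP => _ /trajectP[i im ->].
  by rewrite memv_ker TE -iterD addnC iterD -iterSr x0 iter_lfun0.
apply/negP => /(subvP sT); rewrite memv_ker TE => /eqP /xmin.
by rewrite ltnn.
Qed.

Definition chain_length S x : nat := xget 0%N [set m | is_chain_length S x m].

Lemma chain_lengthP S x :
  nilpotent_end S -> is_chain_length S x (chain_length S x).
Proof.
case=> n Sn; apply: (xgetPex 0%N (P := [set m | is_chain_length S x m])).
have ex : exists m, iter m S x == 0 by exists n; rewrite Sn.
case: (ex_minnP ex) => m /eqP xm mmin.
by exists m; split=> // j /eqP /mmin.
Qed.

Definition chain_span S x : {vspace U} := <<traject S x (chain_length S x)>>%VS.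

Lemma dim_chain_span S x :
  nilpotent_end S -> \dim (chain_span S x) = chain_length S x.
Proof.
move=> /(chain_lengthP x) /chain_free /eqnP ->; exact: size_traject.
Qed.

Lemma chain_span_stable S x y :
  nilpotent_end S -> y \in chain_span S x -> S y \in chain_span S x.
Proof.
move=> /(chain_lengthP x) [x0 _] yX.
suff /subvP : (S @: chain_span S x <= chain_span S x)%VS by apply; apply: memv_img.
rewrite limg_span; apply/span_subvP => _ /mapP[_ /trajectP[i im ->] ->].
rewrite -iterS; case: (ltnP i.+1 (chain_length S x)) => im1.
  by apply/memv_span/trajectP; exists i.+1.
by rewrite (iter_lfun_eq0 im1 x0) mem0v.
Qed.

Section Perturbation.
Context (S T : 'End(U)) (X : {vspace U}).
Hypothesis TS : forall y, T y - S y \in X.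
Hypothesis SX : forall y, y \in X -> S y \in X.

Lemma iter_perturbation n y : iter n T y - iter n S y \in X.
Proof.
elim: n => [|n IH] /=; first by rewrite subrr mem0v.
rewrite -(subrKA (S (iter n T y))) rpredD ?TS //.
by rewrite -linearB SX.
Qed.

(** Every [y] in [Y] is [T^n z] for some [z], and modulo [X] this equals [S^n z = 0]. *)
Lemma stable_sub_perturbation Y :
  nilpotent_end S -> (Y <= T @: Y)%VS -> (Y <= X)%VS.
Proof.
move=> [n Sn] YT.
have YTn m y : y \in Y -> exists2 z, z \in Y & y = iter m T z.
  elim: m y => [|m IH] y yY; first by exists y.
  have [z zY ->] := memv_imgP (subvP YT _ yY).
  by have [t tY ->] := IH _ zY; exists t.
apply/subvP => y /(YTn n) [z _ ->].
by have := iter_perturbation n z; rewrite Sn subr0.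
Qed.

End Perturbation.

(** Fitting's argument: the images of the powers of [T] decrease, and their dimensions cannot drop
    forever. *)
Lemma stable_image T :
  exists n X, (T @: X = X)%VS /\ forall y, iter n T y \in X.
Proof.
pose X n := iter n (lfun_img T) {:U}%VS.
have XS n : (X n.+1 <= X n)%VS.
  by elim: n => [|n IH]; rewrite ?subvf // [X n.+2]/(T @: X n.+1)%VS limgS.
have Xiter n y : iter n T y \in X n.
  by elim: n => [|n IH] /=; rewrite ?memvf // memv_img.
have [[n /eqP Xn]|nex] := pselect (exists n, X n.+1 == X n).
  by exists n, (X n); split; [exact: Xn | exact: Xiter].
have dimX n : (\dim (X n) + n <= \dim {:U})%N.
  elim: n => [|n IH]; first by rewrite addn0.
  apply: leq_trans IH; rewrite addnS -addSn leq_add2r.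
  rewrite ltn_neqAle dimvS // andbT; apply/negP => /eqP eqd; apply: nex.
  by exists n; rewrite eqEdim XS eqd leqnn.
have := dimX (\dim {:U}).+1.
by rewrite addnS ltnNge leq_addl.
Qed.

(* On [X] this is the automorphism sending the [i]-th vector of [vbasis X] to
   [S^i x]; on the complement [ker (projv X)] it is [S]. *)
Definition chain_swap (p : 'End(U) * U) : 'End(U) :=
  let X := chain_span p.1 p.2 in
  ((p.1 \o (\1 - projv X))
   + (lin_ext (vbasis X) (fun i => iter i p.1 p.2) \o projv X))%VF.

Lemma chain_swapE S x y (X := chain_span S x) :
  chain_swap (S, x) y = S (y - projv X y)
    + lin_ext (vbasis X) (fun i => iter i S x) (projv X y).
Proof. by rewrite add_lfunE !comp_lfunE add_lfunE opp_lfunE id_lfunE. Qed.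

Lemma chain_swap_vbasis S x (X := chain_span S x) (i : 'I_(\dim X)) :
  chain_swap (S, x) (vbasis X)`_i = iter i S x.
Proof.
have bX : (vbasis X)`_i \in X by apply: vbasis_mem; rewrite mem_nth ?size_tuple.
rewrite chain_swapE projv_id // subrr linear0 add0r.
by rewrite lin_ext_free // (basis_free (vbasisP X)).
Qed.

Lemma lin_ext_iter_chain S x n (b : n.-tuple U) y :
  nilpotent_end S -> (n <= chain_length S x)%N ->
  lin_ext b (fun i => iter i S x) y \in chain_span S x.
Proof.
move=> nS nm; rewrite lin_extE rpred_sum // => i _; apply/rpredZ/memv_span.
by apply/trajectP; exists i => //; apply: leq_trans nm.
Qed.

Lemma chain_swap_sub S x y :
  nilpotent_end S -> chain_swap (S, x) y - S y \in chain_span S x.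
Proof.
move=> nS; rewrite chain_swapE linearB addrAC [X in X + _]addrAC subrr sub0r.
rewrite rpredD ?rpredN ?chain_span_stable ?memv_proj //.
by apply: lin_ext_iter_chain; rewrite // dim_chain_span.
Qed.

Lemma chain_span_swap S x : nilpotent_end S ->
  (chain_span S x <= chain_swap (S, x) @: chain_span S x)%VS.
Proof.
move=> nS; apply/span_subvP => _ /trajectP[i im ->].
rewrite -(dim_chain_span x nS) in im.
rewrite -(chain_swap_vbasis (Ordinal im)) memv_img // vbasis_mem //.
by rewrite mem_nth ?size_tuple.
Qed.

Lemma chain_span_swap_max S x Y : nilpotent_end S ->
  (Y <= chain_swap (S, x) @: Y)%VS -> (Y <= chain_span S x)%VS.
Proof.
move=> nS; apply: (stable_sub_perturbation _ _ nS) => y.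
  exact: chain_swap_sub.
exact: chain_span_stable.
Qed.

(** Maximality recovers the chain span, hence its [vbasis], whose images under the swap are the
    chain itself. Off the span the swap is [S]. *)
Lemma chain_swap_inj S1 x1 S2 x2 :
  nilpotent_end S1 -> nilpotent_end S2 ->
  chain_swap (S1, x1) = chain_swap (S2, x2) -> (S1, x1) = (S2, x2).
Proof.
move=> n1 n2 E.
have EX : chain_span S1 x1 = chain_span S2 x2.
  apply/eqP; rewrite eqEsubv; apply/andP.
  by split; apply: chain_span_swap_max => //; rewrite -?E ?chain_span_swap // E
     chain_span_swap.
have Em : chain_length S1 x1 = chain_length S2 x2.
  by rewrite -!dim_chain_span // EX.
(* The bound includes the length itself, where both terms vanish: this compares [S1] and [S2] on the
   last chain vector. *)
have Ei i : (i <= chain_length S1 x1)%N -> iter i S1 x1 = iter i S2 x2.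
  rewrite leq_eqVlt => /orP[/eqP ->|im].
    by have [-> _] := chain_lengthP x1 n1; 
      rewrite Em; have [-> _] := chain_lengthP x2 n2.
  have im1 := im; have im2 := im.
  rewrite -(dim_chain_span x1 n1) in im1.
  rewrite Em -(dim_chain_span x2 n2) in im2.
  rewrite -(chain_swap_vbasis (Ordinal im1)) -(chain_swap_vbasis (Ordinal im2)) /=.
  by rewrite E EX.
congr pair; last exact: (Ei 0%N).
have EonX : {in chain_span S1 x1, S1 =1 S2}.
  apply/eqlfun_inP/span_subvP => _ /trajectP[i im ->].
  by apply/eqlfunP; rewrite {2}Ei ?(ltnW im) // -!iterS Ei.
apply/lfunP => y; pose z := projv (chain_span S1 x1) y.
have Ey : S1 (y - z) = S2 (y - z).
  have /lfunP /(_ (y - z)) := E.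
  rewrite !chain_swapE -EX [projv _ (y - z)]linearB /= projv_proj subrr.
  by rewrite subr0 !linear0 !addr0.
by rewrite -(subrK z y) [S1 _]linearD [S2 _]linearD /= Ey (EonX _ (memv_proj _ _)).
Qed.

(** To be used with [R] the image of [D], so that the swapped endomorphism lifts through [D]. *)
Lemma chain_swap_limg S x R : nilpotent_end S ->
  (limg S <= R)%VS -> x \in R -> (limg (chain_swap (S, x)) <= R)%VS.
Proof.
move=> nS /subvP SR xR; apply/subvP => _ /memv_imgP[y _ ->].
have SR' z : S z \in R by apply/SR/memv_img/memvf.
rewrite chain_swapE rpredD // lin_extE rpred_sum // => i _; apply: rpredZ.
by case: (nat_of_ord i) => //= j; apply: SR'.
Qed.

Lemma chain_swap_surj T R : (limg T <= R)%VS ->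
  exists S x, [/\ nilpotent_end S, (limg S <= R)%VS, x \in R
                & chain_swap (S, x) = T].
Proof.
move=> /subvP TR; have [n [X [TX Tn]]] := stable_image T.
have TR' z : T z \in R by apply/TR/memv_img/memvf.
have TX' z : z \in X -> T z \in X by rewrite -{2}TX; apply: memv_img.
have XR z : z \in X -> z \in R by rewrite -TX => /memv_imgP[y _ ->].
(* [w] is the future chain: the swap must send [vbasis X] to it, as [T] does. *)
pose w := map_tuple T (vbasis X).
have wX : basis_of X w.
  rewrite basisEdim size_tuple leqnn andbT -limg_span (span_basis (vbasisP X)).
  by rewrite TX.
have wiX i : w`_i \in X.
  case: (ltnP i (\dim X)) => iX; last by rewrite nth_default ?size_tuple ?mem0v.
  by rewrite (basis_mem wX) // mem_nth ?size_tuple.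
(* The shift along [w]; past the end, the default value [0] of [nth] makes it kill the last
   vector. *)
pose N := lin_ext w (fun i => w`_i.+1).
pose S : 'End(U) := ((T \o (\1 - projv X)) + (N \o projv X))%VF.
have SE y : S y = T (y - projv X y) + N (projv X y).
  by rewrite /S add_lfunE !comp_lfunE add_lfunE opp_lfunE id_lfunE.
have NX y : N y \in X by rewrite lin_extE rpred_sum // => i _; apply/rpredZ/wiX.
have SX y : y \in X -> S y \in X.
  by move=> yX; rewrite SE projv_id // subrr linear0 add0r.
have Sw i : S w`_i = w`_i.+1.
  case: (ltnP i (\dim X)) => iX; last first.
    by rewrite !nth_default ?size_tuple ?linear0 // ltnW.
  rewrite SE projv_id // subrr linear0 add0r.
  by rewrite -[i]/(nat_of_ord (Ordinal iX)) lin_ext_free // (basis_free wX).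
have Siw i j : iter i S w`_j = w`_(i + j).
  by elim: i => //= i ->; rewrite Sw.
have SmX y : y \in X -> iter (\dim X) S y = 0.
  move=> yX; have [P PE] := iter_lfun_pow S (\dim X).
  suff /subvP /(_ _ yX) : (X <= lker P)%VS by rewrite memv_ker PE => /eqP.
  rewrite -(span_basis wX); apply/span_subvP => _ /(nthP 0) [i _ <-].
  by rewrite memv_ker PE Siw nth_default ?size_tuple ?leq_addr.
have TS y : S y - T y \in X.
  rewrite SE linearB /= addrAC [X in X + _]addrAC subrr sub0r.
  by rewrite rpredD ?rpredN // TX' ?memv_proj.
(* After [n] steps [S] lands in [X], as [T] does; [\dim X] more shifts reach [0]. *)
have nS : nilpotent_end S.
  exists (\dim X + n)%N => y; rewrite iterD SmX //.
  rewrite -[iter n S y](subrK (iter n T y)) rpredD ?Tn //.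
  exact: iter_perturbation.
have mX : is_chain_length S w`_0 (\dim X).
  split=> [|j]; first by rewrite SmX.
  rewrite Siw addn0 leqNgt => wj0; apply/negP => jX.
  have : w`_j \in w by rewrite mem_nth ?size_tuple.
  by move=> /(basis_not0 wX); rewrite wj0 eqxx.
have EX : chain_span S w`_0 = X.
  rewrite -[RHS](span_basis wX); congr span.
  rewrite (is_chain_length_inj (chain_lengthP _ nS) mX).
  apply: (@eq_from_nth _ w`_0); rewrite size_traject ?size_tuple // => i iX.
  by rewrite nth_traject // Siw addn0; apply: set_nth_default; rewrite size_tuple.
exists S, w`_0; split=> //; last 2 first.
- exact: XR.
- apply/lfunP => y; rewrite chain_swapE EX SE [projv X (_ - _)]linearB /=.
  rewrite projv_proj subrr subr0 linear0 addr0 lin_extE.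
  under eq_bigr => i _ do
    rewrite Siw addn0 /w /= (nth_map 0) ?size_tuple // -linearZ.
  rewrite -linear_sum -coord_vbasis ?memv_proj //.
  by rewrite -linearD subrK.
- apply/subvP => _ /memv_imgP[y _ ->]; rewrite SE rpredD ?TR' //.
  by rewrite XR.
Qed.

End Endomorphisms.

(** * Lifting the swap along a linear section *)

Section SectionSwap.
Context (K : fieldType) (U W : vectType K) (D : 'Hom(W, U)).

(* [D^-1] is a linear section of [D] over [limg D]; an arrow [A : U -> W] is
   recovered from [D \o A], an endomorphism with image in [limg D], and its
   [ker D]-component [A - D^-1 \o (D \o A)], which is left unchanged. *)
Definition section_swap (q : 'Hom(U, W) * W) : 'Hom(U, W) * W :=
  let S := (D \o q.1)%VF in
  (q.1 + (D^-1 \o (chain_swap (S, D q.2) - S))%VF, q.2 - (D^-1)%VF (D q.2)).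

Lemma comp_section_limg (S : 'End(U)) :
  (limg S <= limg D)%VS -> (D \o (D^-1 \o S))%VF = S.
Proof.
move=> /subvP SD; apply/lfunP => x; rewrite !comp_lfunE limg_lfunVK //.
by apply/SD/memv_img/memvf.
Qed.

Lemma limg_comp_sub (A : 'Hom(U, W)) : (limg (D \o A) <= limg D)%VS.
Proof.
by apply/subvP => _ /memv_imgP[x _ ->]; rewrite comp_lfunE memv_img ?memvf.
Qed.

Lemma limg_sub_lfun (S T : 'End(U)) :
  (limg S <= limg D)%VS -> (limg T <= limg D)%VS -> (limg (S - T) <= limg D)%VS.
Proof.
move=> /subvP SD /subvP TD; apply/subvP => _ /memv_imgP[x _ ->].
rewrite add_lfunE opp_lfunE.
by apply: rpredB; [apply: SD | apply: TD]; rewrite memv_img ?memvf.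
Qed.

Lemma comp_section_swap (A : 'Hom(U, W)) (w : W) : nilpotent_end (D \o A)%VF ->
  (D \o (section_swap (A, w)).1)%VF = chain_swap ((D \o A)%VF, D w).
Proof.
move=> nA; rewrite /section_swap /= comp_lfunDr comp_section_limg.
  by rewrite addrC subrK.
by rewrite limg_sub_lfun ?chain_swap_limg ?limg_comp_sub // memv_img ?memvf.
Qed.

Lemma section_swap_bij :
  set_bij [set q : 'Hom(U, W) * W | nilpotent_end (D \o q.1)%VF]
          [set q | D q.2 = 0] section_swap.
Proof.
split.
- move=> [A w] _ /=.
  by rewrite linearB /= limg_lfunVK ?subrr // memv_img ?memvf.
- move=> [A1 w1] [A2 w2] /set_mem /= n1 /set_mem /= n2 E.
  have := comp_section_swap w1 n1; rewrite E comp_section_swap // => ES.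
  have [EA Ew] := chain_swap_inj n2 n1 ES.
  (* With equal [D]-components, both pairs receive the same corrections, which cancel. *)
  by move: E; rewrite /section_swap /= EA Ew => -[/addIr -> /addIr ->].
- move=> [A z] /= Dz.
  have [S [x [nS SD xD SA]]] := chain_swap_surj (limg_comp_sub A).
  have EA : (D \o (A + (D^-1 \o (S - (D \o A)))))%VF = S.
    by rewrite comp_lfunDr comp_section_limg ?limg_sub_lfun ?limg_comp_sub //
      addrC subrK.
  have Ew : D (z + (D^-1)%VF x) = x by rewrite linearD /= Dz add0r limg_lfunVK.
  (* The [ker D]-components are kept; the [D]-components become [S] and [x]. *)
  exists (A + (D^-1 \o (S - (D \o A)))%VF, z + (D^-1)%VF x).
    by rewrite /= EA.
  rewrite /section_swap /= EA Ew SA addrK -addrA -comp_lfunDr.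
  by rewrite addrA subrK subrr comp_lfun0r addr0.
Qed.

End SectionSwap.

Lemma involutive_set_bij (T : Type) (A B : set T) (F : T -> T) :
  (forall x, F (F x) = x) -> (forall x, A x <-> B (F x)) -> set_bij A B F.
Proof.
move=> FK AB; split=> [x /AB //|x y _ _ /(congr1 F)|y By].
  by rewrite !FK.
by exists (F y); rewrite ?FK //; apply/AB; rewrite FK.
Qed.

(** * The cyclic order on the vertices *)

Section CyclicOrder.
Context (k : nat).
Implicit Types i : 'I_k.

Lemma val_iter_ordS l i : val (iter l (@ordS k) i) = ((i + l) %% k)%N.
Proof.
elim: l => [|l IH]; first by rewrite addn0 modn_small.
by rewrite iterS /= IH addnS -[in LHS]addn1 modnDml addn1.
Qed.

Lemma iter_ordS_order i : iter k (@ordS k) i = i.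
Proof. by apply: val_inj; rewrite val_iter_ordS modnDr modn_small. Qed.

Lemma iter_ordS_inj i l m : (l < k)%N -> (m < k)%N ->
  iter l (@ordS k) i = iter m (@ordS k) i -> l = m.
Proof.
move=> lk mk /(congr1 val); rewrite !val_iter_ordS => /eqP.
by rewrite eqn_modDl !modn_small // => /eqP.
Qed.

Lemma iter_ordS_exists i j : exists2 l, (l < k)%N & iter l (@ordS k) i = j.
Proof.
have k0 : (0 < k)%N by apply: leq_trans (ltn_ord i).
exists ((j + (k - i)) %% k)%N; first by rewrite ltn_mod.
apply: val_inj; rewrite val_iter_ordS modnDmr addnCA subnKC ?modnDr ?modn_small //.
exact: ltnW.
Qed.

Lemma iter_predn_ordS i : iter k.-1 (@ordS k) (ordS i) = i.
Proof.
by rewrite -iterSr prednK ?iter_ordS_order //; apply: leq_trans (ltn_ord i).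
Qed.

End CyclicOrder.

(** * Paths in the quiver *)

Section Quiver.
Context (k : nat) (K : fieldType) (V : 'I_k -> vectType K).
Implicit Types (f : Rep V) (z : Vprod V) (i : 'I_k).

(* Moving vectors in the total space avoids casts between [V (iter k ordS i)]
   and [V i]. *)
Definition step f (u : {i : 'I_k & V i}) : {i : 'I_k & V i} :=
  Tagged V (f (tag u) (tagged u)).

Definition is_zero (u : {i : 'I_k & V i}) : bool := tagged u == 0.

Lemma path_map_step f i l (x : V i) :
  Tagged V (path_map f i l x) = iter l (step f) (Tagged V x).
Proof.
elim: l => [|l IH] /=; first by rewrite id_lfunE.
by rewrite -IH comp_lfunE.
Qed.

Lemma path_map_eq0 f i l (x : V i) :
  (path_map f i l x == 0) = is_zero (iter l (step f) (Tagged V x)).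
Proof. by rewrite -path_map_step. Qed.

Lemma iter_step_zero f l u : is_zero u -> is_zero (iter l (step f) u).
Proof.
by move=> u0; elim: l => //= l /eqP IH; rewrite /is_zero /= IH linear0.
Qed.

Lemma tag_iter_step f l u : tag (iter l (step f) u) = iter l (@ordS k) (tag u).
Proof. by elim: l => //= l ->. Qed.

(** Peels off the first arrow, whereas [path_map] peels off the last. The two vectors have different
    types, so only their vanishing is compared. *)
Lemma path_mapSr_eq0 f i l (x : V i) :
  (path_map f i l.+1 x == 0) = (path_map f (ordS i) l (f i x) == 0).
Proof. by rewrite !path_map_eq0 iterSr. Qed.

Lemma eq_path_map f g i l :
  (forall m, (m < l)%N -> f (iter m (@ordS k) i) = g (iter m (@ordS k) i)) ->
  path_map f i l = path_map g i l.
Proof.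
elim: l => //= l IH fg; rewrite fg // IH // => m ml; apply: fg.
exact: leq_trans ml _.
Qed.

(** Fewer than [k] steps from [ordS i] never traverse the arrow leaving [i]. *)
Lemma path_map_dfwith f i (A : 'Hom(V i, V (ordS i))) l : (l < k)%N ->
  path_map (dfwith f A) (ordS i) l = path_map f (ordS i) l.
Proof.
move=> lk; apply: eq_path_map => m ml; rewrite dfwith_out //.
apply/eqP; rewrite -iterSr => /(@iter_ordS_inj _ i 0) /=.
have mk : (m.+1 < k)%N by apply: leq_trans lk.
by move=> /(_ (ltn_trans (ltn0Sn _) mk) mk).
Qed.

Lemma tagged_ecast (W : vectType K) i j (e : i = j) (h : 'Hom(W, V i)) x :
  Tagged V (ecast a ('Hom(W, V a)) e h x) = Tagged V (h x).
Proof. by case: _ / e. Qed.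

(** * Reduction to one arrow and its return map *)

Section Return.
Variable p : 'I_k.

(** The map [D] of the overview; the cast is needed because the path ends at [p] only up to a proved
    equality. *)
Definition return_map f : 'Hom(V (ordS p), V p) :=
  ecast j ('Hom(V (ordS p), V j)) (iter_predn_ordS p)
    (path_map f (ordS p) k.-1).

Lemma return_map_step f x :
  Tagged V (return_map f x) = iter k.-1 (step f) (Tagged V x).
Proof.
by rewrite tagged_ecast path_map_step.
Qed.

Lemma return_map_eq0 f x :
  (return_map f x == 0) = (path_map f (ordS p) k.-1 x == 0).
Proof. by rewrite path_map_eq0 -return_map_step. Qed.

Lemma return_map_dfwith f (A : 'Hom(V p, V (ordS p))) :
  return_map (dfwith f A) = return_map f.
Proof.
rewrite /return_map path_map_dfwith // prednK //.
exact: leq_trans (ltn_ord p).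
Qed.

Lemma iter_return_step f n x :
  Tagged V (iter n (return_map f \o f p)%VF x)
  = iter (n * k) (step f) (Tagged V x).
Proof.
have k0 : (0 < k)%N by apply: leq_trans (ltn_ord p).
have iterk u : iter k (step f) u = iter k.-1 (step f) (step f u).
  by rewrite -iterSr prednK.
elim: n => //= n IH.
by rewrite mulSn iterD -IH iterk comp_lfunE return_map_step.
Qed.

(** A path from any [i] reaches [p] after some [d] steps, and [n] full turns from there kill it. *)
Lemma nilpotent_repP f :
  nilpotent_rep f <-> nilpotent_end (return_map f \o f p)%VF.
Proof.
have k0 : (0 < k)%N by apply: leq_trans (ltn_ord p).
split=> [/(_ p) [n fn]|[n fn] i].
  exists n => x; apply/eqP; rewrite -[_ == 0]/(is_zero (Tagged V _)).
  by rewrite iter_return_step -path_map_eq0 fn ?leq_pmulr // lfunE.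
have [d _ dp] := iter_ordS_exists i p.
exists (n * k + d)%N => l nl; apply/lfunP => x; apply/eqP; rewrite lfunE /=.
rewrite path_map_eq0 -(subnK nl) iterD iter_step_zero // iterD.
have := tag_iter_step f d (Tagged V x); rewrite dp /=.
case: (iter d _ _) => j y /= jp; rewrite {j}jp in y *.
by rewrite -iter_return_step /is_zero /= fn.
Qed.

Definition arrow_swap (q : Rep V * Vprod V) : Rep V * Vprod V :=
  let r := section_swap (return_map q.1) (q.1 p, q.2 (ordS p)) in
  (dfwith q.1 r.1, dfwith q.2 r.2).

Lemma arrow_swap_bij :
  set_bij (nilpotent_cone (V := V) `*` [set: Vprod V])
          [set q : Rep V * Vprod V |
            path_map q.1 (ordS p) k.-1 (q.2 (ordS p)) = 0] arrow_swap.
Proof.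
have dfwith_id (T : 'I_k -> Type) (g : forall i, T i) i (x y : T i) :
    x = g i -> dfwith (dfwith g y) x = g.
  move=> ->; apply: functional_extensionality_dep => j.
  case: (eqVneq i j) => [<-|ij]; first by rewrite dfwith_in.
  by rewrite !dfwith_out.
split.
- move=> [f z] [/nilpotent_repP nf _] /=; apply/eqP; rewrite -return_map_eq0.
  rewrite return_map_dfwith dfwith_in.
  have [/(_ (f p, z (ordS p)) nf) /= -> _ _] := section_swap_bij (return_map f).
  by [].
- move=> [f1 z1] [f2 z2] /set_mem [/nilpotent_repP n1 _].
  move=> /set_mem [/nilpotent_repP n2 _] [Ef Ez]; simpl in *.
  have ED : return_map f1 = return_map f2.
    by have := congr1 return_map Ef; rewrite !return_map_dfwith.
  have Er := f_equal2 pair (congr1 (fun f : Rep V => f p) Ef)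
    (congr1 (fun z : Vprod V => z (ordS p)) Ez).
  rewrite /= !dfwith_in ED in Er.
  have [_ inj _] := section_swap_bij (return_map f2).
  have [Efp Ezp] : (f1 p, z1 (ordS p)) = (f2 p, z2 (ordS p)).
    by apply: (inj (f1 p, z1 (ordS p)) (f2 p, z2 (ordS p)) _ _ Er);
      apply/mem_set; rewrite /= -?ED // ED.
  (* [Ef] and [Ez] only equate the overwritten families; writing the common old entries back
     recovers the originals. *)
  have := congr1 (fun g : Vprod V => dfwith g (z1 (ordS p))) Ez.
  have := congr1 (fun g : Rep V => dfwith g (f1 p)) Ef.
  by rewrite /= !dfwith_id // => -> ->.
- move=> [f z] /= /eqP; rewrite -return_map_eq0 => /eqP Dz.
  have [_ _ /(_ (f p, z (ordS p)) Dz) [[A w] /= nA E]] :=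
    section_swap_bij (return_map f).
  exists (dfwith f A, dfwith z w).
    by split=> //; apply/nilpotent_repP; rewrite /= return_map_dfwith dfwith_in.
  rewrite /arrow_swap /= return_map_dfwith !dfwith_in.
  by case: E => -> ->; rewrite !dfwith_id.
Qed.

End Return.

(* When [z i != 0], the values [f i (z i)] and [z (ordS i)] are exchanged. *)
Definition value_swap i (q : Rep V * Vprod V) : Rep V * Vprod V :=
  let: (f, z) := q in
  if z i == 0 then q else
  (dfwith f (f i + lin_ext [tuple z i] (fun=> z (ordS i) - f i (z i))),
   dfwith z (f i (z i))).

(** * Exchanging values around the cycle *)

Section ValueSwap.
Hypothesis hk : (2 <= k)%N.

Lemma ordS_neq i : ordS i != i.
Proof.
apply/eqP => /(@iter_ordS_inj _ i 1 0 hk) /=.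
by move=> /(_ (ltn_trans (ltn0Sn _) hk)).
Qed.

(** Since [ordS i] differs from [i], [z i] is unchanged: the second pass takes the same branch and
    its correction to [f i] is the opposite one. *)
Lemma value_swapK i q : value_swap i (value_swap i q) = q.
Proof.
case: q => f z /=; case: (eqVneq (z i) 0) => [zi|zi] /=; first by rewrite zi eqxx.
rewrite dfwith_out ?ordS_neq // (negPf zi) !dfwith_in.
have fzi : free [tuple z i] by rewrite seq1_free.
have Li (W : vectType K) (c : W) : lin_ext [tuple z i] (fun=> c) (z i) = c.
  exact: (lin_ext_free (fun=> c) ord0 fzi).
rewrite add_lfunE Li [_ + (z _ - _)]addrC subrK; congr pair.
  apply: functional_extensionality_dep => j.
  case: (eqVneq i j) => [<-|ij]; last by rewrite !dfwith_out.
  rewrite dfwith_in; apply/lfunP => x.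
  rewrite !add_lfunE !lin_extE !big_ord1 -addrA -scalerDr.
  by rewrite addrA subrK subrr scaler0 addr0.
apply: functional_extensionality_dep => j.
case: (eqVneq (ordS i) j) => [<-|ij]; last by rewrite !dfwith_out.
by rewrite dfwith_in.
Qed.

(* Interpolates between "the path starting at [z s] dies" ([j = 0]) and "some
   [z i] vanishes" ([j = k - 1]). *)
Definition dies_from s j : set (Rep V * Vprod V) :=
  [set q : Rep V * Vprod V |
    (exists2 l, (l < j)%N & q.2 (iter l (@ordS k) s) = 0)
    \/ path_map q.1 (iter j (@ordS k) s) (k.-1 - j)
         (q.2 (iter j (@ordS k) s)) = 0].

(** Let [i] be the [j]-th vertex after [s]. If [z i = 0], both sides hold. Otherwise the new vector
    at [ordS i] is [f i (z i)], so the path from [z i] dies iff the shorter one from there does;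
    earlier vectors and later arrows are untouched. *)
Lemma value_swap_dies s j q : (j.+1 < k)%N ->
  dies_from s j q <-> dies_from s j.+1 (value_swap (iter j (@ordS k) s) q).
Proof.
case: q => f z jk; rewrite /dies_from /=.
set i := iter j _ s.
have km : (k.-1 - j = (k.-1 - j.+1).+1)%N.
  by rewrite -subSn ?subSS // -ltnS prednK // (ltn_trans _ jk).
case: (eqVneq (z i) 0) => zi.
  split=> _; first by left; exists j.
  by right; rewrite zi linear0.
have zl l : (l <= j)%N ->
    dfwith z (f i (z i)) (iter l (@ordS k) s) = z (iter l (@ordS k) s).
  move=> lj; rewrite dfwith_out //; apply/eqP.
  move=> /(@iter_ordS_inj _ s j.+1 l jk (leq_ltn_trans (leqW lj) jk)) jl.
  by rewrite -jl ltnn in lj.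
have mk : (k.-1 - j.+1 < k)%N.
  by rewrite (leq_ltn_trans (leq_subr _ _)) // prednK // (ltn_trans _ jk).
split=> -[[l lj z0]|].
- by left; exists l; rewrite /= ?zl // ltnW.
- rewrite km => /eqP; rewrite path_mapSr_eq0 => /eqP zp.
  by right; rewrite /= dfwith_in path_map_dfwith.
- move: lj; rewrite ltnS => lj; left; exists l; last by rewrite -zl.
  rewrite ltn_neqAle lj andbT; apply: contra_neqN zi => /eqP jl.
  by move: z0; rewrite /= jl zl.
- rewrite /= dfwith_in path_map_dfwith // => /eqP zp.
  by right; rewrite km; apply/eqP; rewrite path_mapSr_eq0.
Qed.

Lemma dies_from_bij s j : (j < k)%N ->
  exists F, set_bij (dies_from s 0) (dies_from s j) F.
Proof.
elim: j => [|j IH] jk.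
  by exists id; apply: involutive_set_bij.
have [F Fbij] := IH (ltnW jk).
exists (value_swap (iter j (@ordS k) s) \o F); apply: set_bij_comp Fbij _.
apply: involutive_set_bij => q; first exact: value_swapK.
exact: value_swap_dies.
Qed.

Lemma dies_from0 s :
  dies_from s 0 = [set q : Rep V * Vprod V | path_map q.1 s k.-1 (q.2 s) = 0].
Proof.
apply/seteqP; split=> q /=; rewrite /dies_from /= subn0; last by right.
by case=> // -[].
Qed.

(** The remaining path is empty, so its clause covers the last vertex, and [k] consecutive vertices
    exhaust the cycle. *)
Lemma dies_from_last s : dies_from s k.-1 = [set: Rep V] `*` some_zero (V := V).
Proof.
have k0 : (0 < k)%N by apply: leq_trans hk.
apply/seteqP; split=> -[f z]; rewrite /dies_from /= subnn /=.
  case=> [[l _ zl]|]; first by split=> //; exists (iter l (@ordS k) s).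
  by rewrite id_lfunE => zl; split=> //; exists (iter k.-1 (@ordS k) s).
case=> _ [i zi]; have [l lk li] := iter_ordS_exists s i.
rewrite -(prednK k0) ltnS leq_eqVlt in lk; case/orP: lk => [/eqP lk|lk].
  by right; rewrite -lk li zi linear0.
by left; exists l; rewrite ?li.
Qed.

End ValueSwap.

End Quiver.

Theorem theorem3p5 (k : nat) (hk : (2 <= k)%N) (K : fieldType)
    (beta : 'I_k -> nat) (V : 'I_k -> vectType K)
    (hdim : forall i : 'I_k, \dim {: V i} = beta i)
    (e : forall i : 'I_k, (beta i).-tuple (V i))
    (he : forall i : 'I_k, basis_of {: V i} (e i)) :
  exists F : Rep V * Vprod V -> Rep V * Vprod V,
    set_bij (nilpotent_cone (V := V) `*` [set: Vprod V])
            ([set: Rep V] `*` some_zero (V := V)) F.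
Proof.
have k0 : (0 < k)%N := ltnW hk.
pose p : 'I_k := Ordinal k0.
have kp : (k.-1 < k)%N by rewrite prednK.
(* Starting at [ordS p] makes [dies_from] at [0] the target of [arrow_swap p]. *)
have [F Fbij] := dies_from_bij V hk (ordS p) kp.
exists (F \o arrow_swap p); rewrite -(dies_from_last V hk (ordS p)).
apply: set_bij_comp Fbij; rewrite dies_from0.
exact: arrow_swap_bij.
Qed.
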